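(* Let $T$ be a $2$-distinguishable tree of order $|T| \geq 3$. Then the fixing density of $T$ satisfies $F(T)/|T| \leq 4/11$. Moreover, this bound is sharp: there exists a $2$-distinguishable tree of order at least $3$ whose fixing density equals $4/11$.
   Context: Graphs are finite and simple; a tree is a connected graph without cycles, and $|G|$ denotes the order (number of vertices) of a graph $G$. For a positive integer $D$, a graph $G$ is $D$-distinguishable if there is a (not necessarily proper) coloring of its vertices using at most $D$ colors such that the only automorphism of $G$ preserving the color of every vertex is the identity. A fixing set of $G$ is a set $S \subseteq V(G)$ such that the only automorphism of $G$ fixing every vertex of $S$ is the identity. The fixing number $F(G)$ is the minimum cardinality of a fixing set of $G$, and the fixing density of $G$ is $F(G)/|G|$. *)

(* Defs.v *)
From HB Require Import structures.
From mathcomp Require Import all_boot all_order all_algebra all_fingroup.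

Set Implicit Arguments.
Unset Strict Implicit.
Unset Printing Implicit Defensive.

Import Order.TTheory GRing.Theory Num.Theory.

Record sgraph := SGraph {
  vertex :> finType;
  adj : rel vertex;
  adj_sym : symmetric adj;
  adj_irrefl : irreflexive adj }.

Arguments adj {s} : rename.

Definition connected (G : sgraph) : Prop :=
  0 < #|G| /\ forall x y : G, connect adj x y.

(* In [ucycle adj p] consecutive vertices of [p] are adjacent, cyclically, and
   [p] has no repetition.  This also holds when [p] is empty or lists the two
   ends of an edge, neither of which is a cycle of a simple graph. *)
Definition acyclic (G : sgraph) : Prop :=
  forall p : seq G, ucycle adj p -> size p <= 2.

Definition tree (G : sgraph) : Prop := connected G /\ acyclic G.

Definition automorphism (G : sgraph) (s : {perm G}) : bool :=
  [forall x : G, forall y : G, adj (s x) (s y) == adj x y].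

Definition distinguishable (D : nat) (G : sgraph) : Prop :=
  exists c : G -> 'I_D, forall s : {perm G},
    automorphism s -> (forall x : G, c (s x) = c x) -> s = 1%g.

Definition fixing_set (G : sgraph) (S : {set G}) : bool :=
  [forall s : {perm G},
     automorphism s ==> [forall x in S, s x == x] ==> (s == 1%g)].

Lemma fixing_setT (G : sgraph) : fixing_set [set: G].
Proof.
apply/forallP=> s; apply/implyP=> _; apply/implyP=> /forallP fix_s.
apply/eqP/permP=> x; rewrite perm1; apply/eqP.
by have := fix_s x; rewrite inE.
Qed.

(* By [fixing_setT] the default value of this minimum is itself a fixing set. *)
Definition fixing_number (G : sgraph) : nat :=
  #|[arg min_(S < [set: G] | fixing_set S) #|S|]|.

Definition fixing_density (G : sgraph) : rat :=
  ((fixing_number G)%:R / #|G|%:R)%R.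

(* Main.v *)
Require Import Defs.
From HB Require Import structures.
From mathcomp Require Import all_boot all_order all_algebra all_fingroup.
From mathcomp Require Import zify.
Import Order.TTheory GRing.Theory Num.Theory.

(** Root the tree at a vertex [r] and call a vertex childless if it has no
    child, a stem if its only child is childless, and big otherwise.  Two
    childless siblings can be exchanged by an automorphism, and so can two
    sibling stems together with their children.  A distinguishing 2-coloring
    must therefore give distinct colors to childless siblings, and distinct
    pairs of colors to sibling stems: a vertex has at most 2 childless children
    ([leaf_kids_le2]) and at most 4 stem children ([stem_kids_le4]).  These two
    bounds are all that the upper bound takes from the hypothesis.

    The fixing set [fixing_choice r] takes, at every vertex [p], all but one of
    the childless children of [p], all but one of its stem children, and [p]
    itself when [p] has exactly one stem child and at most one childless child.
    The last rule makes every vertex all of whose children are childless or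
    stems, and which is itself neither, see a chosen vertex among itself and
    its children.

    It is a fixing set ([fixing_choice_fixes]).  Let [s] be an automorphism
    that fixes all chosen vertices.  If it fixes the root, it commutes with the
    parent map, so it fixes every vertex that has a fixed child; going up from
    the deepest big vertices, all big vertices are fixed.  Going down from the
    root, a childless vertex or a stem whose parent is fixed can only move to
    a sibling of the same kind, and one of the two is chosen.  There remains
    to have [s r = r]: instead of working at the center of the tree, the root
    is put at the far end of a branch, next to two leaves or to a path of
    length two ([exists_clustered_root]); then a chosen vertex at the root or
    just below it ties down the root ([fixes_root]).

    It is small ([fixing_choice_le]).  A big vertex [p] with [l] childless and
    [q] stem children accounts for [1 + l + 2 * q] vertices, itself and these
    small branches, against at most [l.-1 + q.-1] chosen ones, plus one when
    [q = 1] and [l <= 1].  As [l <= 2] and [q <= 4], four times the former is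
    at least eleven times the latter: a pair of leaves falls short by 3, four
    stems fall short by 1, and [p] itself brings in 4.

    Equality thus requires every big vertex to have exactly 2 childless and
    4 stem children; the [spider] with these eleven vertices attains 4/11. *)

Set Implicit Arguments.
Unset Strict Implicit.
Unset Printing Implicit Defensive.

(** * Rooted trees *)

(** Adjacency in the graph minus the vertex [u].  Excluding [u] at both ends
    keeps the relation symmetric, hence [connect (away u)] too. *)
Definition away (G : sgraph) (u x y : G) : bool :=
  [&& adj x y, x != u & y != u].

(** The parent of [u] is its neighbor on the side of the root once [u] is
    removed.  This involves no distance and no choice of paths, so it can be
    compared between two roots and transported by automorphisms.  By default
    the root is its own parent ([par_root]). *)
Definition par (G : sgraph) (r u : G) : G :=
  odflt u [pick a | adj u a && connect (away u) a r].

Definition kids (G : sgraph) (r p : G) : {set G} :=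
  [set u | (u != r) && (par r u == p)].

Definition childless (G : sgraph) (r v : G) : bool := kids r v == set0.

Definition stem (G : sgraph) (r v : G) : bool :=
  (#|kids r v| == 1) && [forall u in kids r v, childless r u].

Definition leaf_kids (G : sgraph) (r p : G) : {set G} :=
  [set u in kids r p | childless r u].

Definition stem_kids (G : sgraph) (r p : G) : {set G} :=
  [set u in kids r p | stem r u].

Lemma mem_leaf_kids (G : sgraph) (r p u : G) :
  (u \in leaf_kids r p) = (u \in kids r p) && childless r u.
Proof. by rewrite [LHS]inE. Qed.

Lemma mem_stem_kids (G : sgraph) (r p u : G) :
  (u \in stem_kids r p) = (u \in kids r p) && stem r u.
Proof. by rewrite [LHS]inE. Qed.

Section AnyGraph.

Variable G : sgraph.

Lemma adj_neq (u v : G) : adj u v -> u != v.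
Proof. by apply: contraTneq => ->; rewrite adj_irrefl. Qed.

Lemma away_sym (u : G) : connect_sym (away u).
Proof.
by apply: sym_connect_sym => x y; rewrite /away adj_sym [(x != u) && _]andbC.
Qed.

Lemma path_away (u x : G) (p : seq G) :
  path adj x p -> u \notin x :: p -> path (away u) x p.
Proof.
elim: p x => //= y p IHp x /andP[xy yp].
rewrite !inE !negb_or => /and3P[ux uy up].
rewrite /away xy [x == u]eq_sym [y == u]eq_sym ux uy /= IHp //.
by rewrite inE negb_or uy.
Qed.

Lemma automorphismP (s : {perm G}) :
  reflect (forall x y, adj (s x) (s y) = adj x y) (automorphism s).
Proof.
apply: (iffP forallP) => [s_adj x y | s_adj x].
  by have /forallP/(_ y)/eqP := s_adj x.
by apply/forallP=> y; rewrite s_adj.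
Qed.

End AnyGraph.

Section Tree.

Variable G : sgraph.
Hypothesis treeG : tree G.

(** Two distinct neighbors of [u] joined by a path that avoids [u] would close
    a cycle through [u]. *)
Lemma no_detour (u a b : G) :
  adj u a -> adj u b -> connect (away u) a b -> a = b.
Proof.
move=> ua ub /connectP[p0 p0P].
case/shortenP: p0P => p pP p_uniq _ def_b.
have pA : path adj a p by apply: sub_path pP => x y /andP[].
have u_notin : u \notin a :: p.
  rewrite inE negb_or adj_neq //=.
  elim: (p) (a) pP => //= y q IHq x /andP[/and3P[_ _ yu] /IHq q_u].
  by rewrite inE negb_or eq_sym yu.
have : ucycle adj (u :: a :: p).
  apply/andP; split; last by rewrite cons_uniq u_notin.
  by rewrite /= ua /= rcons_path pA -def_b adj_sym.
by case: treeG => _ acG /acG; case: (p) def_b.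
Qed.

Section Rooted.

Variable r : G.

Lemma par_eq (u a : G) : adj u a -> connect (away u) a r -> par r u = a.
Proof.
move=> ua ar; rewrite /par; case: pickP => [b /andP[ub br] | /(_ a)] /=.
  by apply: (@no_detour u) => //; rewrite (connect_trans br) // away_sym.
by rewrite ua ar.
Qed.

Lemma root_path (u : G) :
  exists p, [/\ path adj u p, last u p = r & uniq (u :: p)].
Proof.
case: treeG => -[_ conG] _; have /connectP[p0 p0P ->] := conG u r.
by case/shortenP: p0P => p; exists p.
Qed.

Lemma par_head (u a : G) (p : seq G) :
  path adj u (a :: p) -> last a p = r -> u \notin a :: p -> par r u = a.
Proof.
case/andP=> ua ap pr u_notin; apply: par_eq => //.
by apply/connectP; exists p => //; apply: path_away.
Qed.

Lemma par_root : par r r = r.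
Proof.
rewrite /par; case: pickP => //= a /andP[ra /connectP[p pP def_r]].
case: (lastP p) pP def_r => [|q x]; first by move=> _ /= ->.
by rewrite last_rcons rcons_path => /andP[_ /and3P[_ _ /negP xr]] /esym/eqP.
Qed.

Lemma adj_par (u : G) : u != r -> adj u (par r u).
Proof.
move=> u_r; have [[|a p] [uP /= pr u_uniq]] := root_path u.
  by rewrite pr eqxx in u_r.
rewrite (par_head uP) //; first by case/andP: uP.
by case/andP: u_uniq.
Qed.

(** Take a path without repetition from [v] to the root: either it avoids [u],
    and then [v] is on the root side of [u], or its part after [u] avoids [v],
    and then [u] is on the root side of [v]. *)
Lemma adj_parP (u v : G) : adj u v -> par r u = v \/ par r v = u.
Proof.
move=> uv; have [q [vP vr v_uniq]] := root_path v.
have [u_in | u_notin] := boolP (u \in v :: q); last first.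
  by left; apply: (@par_head _ _ q); rewrite //= uv.
right; move: u_in; rewrite inE (negPf (adj_neq uv)) /= => u_in.
case/splitPr: u_in vP vr v_uniq => q1 q2.
rewrite cat_path last_cat /= => /and3P[_ _ uP] ur v_uniq.
apply: (@par_head _ _ q2); rewrite //= 1?adj_sym ?uv //.
by case/andP: v_uniq; rewrite mem_cat negb_or => /andP[].
Qed.

Lemma adjE (u v : G) :
  adj u v = (u != v) && ((par r u == v) || (par r v == u)).
Proof.
apply/idP/andP=> [uv | [u_v]].
  by split; [exact: adj_neq | apply/orP; case: (adj_parP uv) => ->; auto].
case/orP=> /eqP def; [rewrite -def | rewrite adj_sym -def]; apply: adj_par.
  by apply: contraNneq u_v => ur; rewrite -def ur par_root.
by apply: contraNneq u_v => vr; rewrite -def vr par_root.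
Qed.

Lemma kidsP (u p : G) : reflect (u != r /\ par r u = p) (u \in kids r p).
Proof. by rewrite inE; apply: (iffP andP) => -[? /eqP]. Qed.

Lemma kids_adj (u p : G) : u \in kids r p -> adj u p.
Proof. by case/kidsP=> u_r <-; apply: adj_par. Qed.

Lemma adj_kids (x y : G) : adj x y -> y = par r x \/ y \in kids r x.
Proof.
move=> xy; case: (adj_parP xy) => [-> | yx]; [by left | right].
apply/kidsP; split=> //; apply: contraTneq xy => y_r.
by rewrite -yx y_r par_root adj_irrefl.
Qed.

(** Induction from the root downwards. *)
Lemma par_ind (P : G -> Prop) :
  P r -> (forall u, u != r -> P (par r u) -> P u) -> forall u, P u.
Proof.
move=> Pr Ppar u; have [p [uP pr u_uniq]] := root_path u.
elim: p u uP pr u_uniq => [|a p IHp] u uP /= pr u_uniq; first by rewrite pr.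
have [-> // | u_r] := eqVneq u r; apply: Ppar => //.
case/andP: u_uniq => u_notin a_uniq; rewrite (par_head uP) //.
by apply: IHp => //; case/andP: uP.
Qed.

Lemma par_depth :
  exists d : G -> nat, forall u, u != r -> d (par r u) < d u.
Proof.
have reach u : exists k, iter k (par r) u == r.
  elim/par_ind: u => [|u _ [k]]; first by exists 0 => /=.
  by rewrite -iterSr; exists k.+1.
exists (fun u => ex_minn (reach u)) => u u_r.
case: (ex_minnP (reach u)) => -[|k]; first by rewrite (negPf u_r).
rewrite iterSr => k_r _; case: ex_minnP => m _ m_min.
by rewrite ltnS m_min.
Qed.

(** Induction from the childless vertices upwards. *)
Lemma kids_ind (P : G -> Prop) :
  (forall v, (forall u, u \in kids r v -> P u) -> P v) -> forall v, P v.
Proof.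
move=> Pkids v; have [d d_par] := par_depth.
have [n] := ubnP (\max_x d x - d v).
elim: n v => // n IHn v v_n; apply: Pkids => u /kidsP[u_r u_v].
apply: IHn; have := d_par u u_r; rewrite u_v.
have := leq_bigmax (F := d) u; move: v_n; lia.
Qed.

Lemma kid_par_neq (u p : G) : u \in kids r p -> u != p.
Proof. by move/kids_adj/adj_neq. Qed.

Lemma childlessP (v : G) :
  reflect (forall x, x \notin kids r v) (childless r v).
Proof.
apply: (iffP eqP) => [-> x | no_kid]; first by rewrite inE.
by apply/setP=> x; rewrite (negPf (no_kid x)) inE.
Qed.

Lemma stemP (v : G) :
  reflect (exists2 k, kids r v = [set k] & childless r k) (stem r v).
Proof.
apply: (iffP andP) => [[/cards1P[k def_k] /forall_inP k_leaf] | [k def_k ?]].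
  by exists k; rewrite // k_leaf // def_k set11.
split; first by rewrite def_k cards1.
by apply/forall_inP=> x; rewrite def_k => /set1P->.
Qed.

Lemma childless_not_stem (v : G) : childless r v -> stem r v = false.
Proof. by move/eqP=> v0; rewrite /stem v0 cards0. Qed.

Section Commuting.

Variable s : {perm G}.
Hypothesis s_r : s r = r.

(** Adjacency is determined by the parent map ([adjE]). *)
Lemma commuting_automorphism :
  (forall u, u != r -> par r (s u) = s (par r u)) -> automorphism s.
Proof.
move=> s_par; have s_par' u : par r (s u) = s (par r u).
  by have [-> | /s_par //] := eqVneq u r; rewrite s_r par_root s_r.
by apply/automorphismP=> x y; rewrite !adjE !s_par' !inj_eq //; exact: perm_inj.
Qed.

Hypothesis s_aut : automorphism s.

(** An automorphism that fixes the root carries the graph minus [u] to the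
    graph minus [s u], and the side of the root to the side of the root. *)
Lemma par_aut (u : G) : par r (s u) = s (par r u).
Proof.
have [-> | u_r] := eqVneq u r; first by rewrite s_r par_root s_r.
have s_adj := automorphismP s s_aut.
apply: par_eq; first by rewrite s_adj adj_par.
have: connect (away u) (par r u) r.
  have [[|a p] [uP /= pr u_uniq]] := root_path u.
    by rewrite pr eqxx in u_r.
  case/andP: u_uniq => u_notin _; rewrite (par_head uP) //.
  apply/connectP; exists p => //; apply: path_away => //.
  by case/andP: uP.
case/connectP=> p pP def_r; apply/connectP; exists (map s p).
  apply: homo_path pP => x y.
  by rewrite /away s_adj !inj_eq //; exact: perm_inj.
by rewrite last_map -def_r s_r.
Qed.

Lemma kids_aut (v : G) : kids r (s v) = s @: kids r v.
Proof.
apply/setP=> x; rewrite -(permKV s x); set y := (s^-1)%g x.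
rewrite (mem_imset _ _ (@perm_inj _ s)) !inE par_aut.
by rewrite -{1}s_r !inj_eq //; exact: perm_inj.
Qed.

Lemma childless_aut (v : G) : childless r (s v) = childless r v.
Proof. by rewrite /childless kids_aut imset_eq0. Qed.

Lemma stem_aut (v : G) : stem r (s v) = stem r v.
Proof.
rewrite /stem kids_aut card_imset; last exact: perm_inj.
congr (_ && _); apply/forall_inP/forall_inP=> kids0 u.
  by move=> uv; rewrite -childless_aut kids0 // imset_f.
by case/imsetP=> x xv ->; rewrite childless_aut kids0.
Qed.

End Commuting.

End Rooted.
End Tree.

(** * Twin branches and 2-colorings *)

Section Swaps.

Variables (G : sgraph) (r : G).
Hypothesis treeG : tree G.

(** The transposition commutes with the parent map, as no other vertex has [u]
    or [v] as its parent. *)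
Lemma swap_leaves_aut (p u v : G) :
  u \in leaf_kids r p -> v \in leaf_kids r p -> automorphism (tperm u v).
Proof.
rewrite !inE => /andP[/andP[u_r /eqP u_p] /childlessP u0].
move=> /andP[/andP[v_r /eqP v_p] /childlessP v0].
apply: (@commuting_automorphism _ treeG r).
  by rewrite tpermD.
have p_u : u != p.
  by apply: contraTneq (u0 u) => def_u; rewrite inE u_r u_p def_u eqxx.
have p_v : v != p.
  by apply: contraTneq (v0 v) => def_v; rewrite inE v_r v_p def_v eqxx.
move=> x x_r; case: tpermP => [->|->|_ _].
- by rewrite v_p u_p tpermD.
- by rewrite v_p u_p tpermD.
rewrite tpermD //; rewrite eq_sym.
  by apply: contra (u0 x) => /eqP x_u; apply/kidsP.
by apply: contra (v0 x) => /eqP x_v; apply/kidsP.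
Qed.

(** The branches [u]--[k] and [v]--[l] are exchanged as a whole, so that the
    permutation still commutes with the parent map. *)
Lemma swap_stems_aut (p u v k l : G) :
  u \in stem_kids r p -> v \in stem_kids r p -> u != v ->
  kids r u = [set k] -> kids r v = [set l] ->
  automorphism (tperm u v * tperm k l)%g.
Proof.
rewrite !inE => /andP[/andP[u_r /eqP u_p] /stemP[k' def_u k0]].
move=> /andP[/andP[v_r /eqP v_p] /stemP[l' def_v l0]] u_v uk vl.
have {def_u}def_k: k' = k by apply/set1P; rewrite -uk def_u set11.
have {def_v}def_l: l' = l by apply/set1P; rewrite -vl def_v set11.
move: k0 l0; rewrite {}def_k {}def_l => /childlessP k0 /childlessP l0.
have [k_r k_u]: k != r /\ par r k = u by apply/kidsP; rewrite uk set11.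
have [l_r l_v]: l != r /\ par r l = v by apply/kidsP; rewrite vl set11.
have k_l : k != l by apply: contraNneq u_v => def_k; rewrite -k_u def_k l_v.
have u_k : u != k by rewrite eq_sym (kid_par_neq treeG (r := r)) // uk set11.
have v_l : v != l by rewrite eq_sym (kid_par_neq treeG (r := r)) // vl set11.
have u_l : u != l by apply: contraTneq (l0 k) => <-; rewrite uk set11.
have v_k : v != k by apply: contraTneq (k0 l) => <-; rewrite vl set11.
have pu : u \in kids r p by apply/kidsP.
have pv : v \in kids r p by apply/kidsP.
have p_u : u != p by apply: (kid_par_neq treeG) pu.
have p_v : v != p by apply: (kid_par_neq treeG) pv.
have p_k : k != p by apply: contraTneq pu => <-; apply: k0.
have p_l : l != p by apply: contraTneq pv => <-; apply: l0.
apply: (@commuting_automorphism _ treeG r); first by rewrite permM !tpermD.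
move=> x x_r; rewrite !permM.
case: (tpermP u v x) => [->|->|x_u x_v].
- by rewrite u_p (tpermD p_u p_v) !tpermD // eq_sym.
- by rewrite v_p (tpermD p_u p_v) !tpermD // eq_sym.
case: tpermP => [->|->|x_k x_l].
- by rewrite l_v k_u tpermL tpermD // eq_sym.
- by rewrite l_v k_u tpermR tpermD // eq_sym.
have no_kid w : x \notin kids r w -> w != par r x.
  by apply: contraNneq => def_w; apply/kidsP.
by rewrite !tpermD // no_kid ?k0 ?l0 // ?uk ?vl; apply/set1P.
Qed.

Hypothesis distG : distinguishable 2 G.

(** A 2-coloring that distinguishes is injective on childless siblings, for
    otherwise a transposition would preserve it. *)
Lemma leaf_kids_le2 (p : G) : #|leaf_kids r p| <= 2.
Proof.
have [c c_dist] := distG; rewrite -[2]card_ord.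
apply: (@leq_card_in _ _ c) => u v up vp c_uv.
have s1 : tperm u v = 1%g.
  by apply: c_dist (swap_leaves_aut up vp) _ => x; case: tpermP => [->|->|].
by rewrite -(tpermL u v) s1 perm1.
Qed.

Definition only_kid (u : G) : G := odflt u [pick k in kids r u].

Lemma only_kidE (u : G) : stem r u -> kids r u = [set only_kid u].
Proof.
case/stemP=> k def_u _; rewrite /only_kid; case: pickP => [x | /(_ k)] /=.
  by rewrite def_u => /set1P->.
by rewrite def_u set11.
Qed.

(** Likewise the pair formed by the colors of a stem and of its child takes
    distinct values on sibling stems, and there are only four such pairs. *)
Lemma stem_kids_le4 (p : G) : #|stem_kids r p| <= 4.
Proof.
have [c c_dist] := distG.
have -> : 4 = #|{: 'I_2 * 'I_2}| by rewrite card_prod card_ord.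
apply: (@leq_card_in _ _ (fun u => (c u, c (only_kid u)))).
move=> u v up vp [c_u c_k]; have [// | u_v] := eqVneq u v.
have [uS vS] : stem r u /\ stem r v.
  by move: up vp; rewrite !inE => /andP[_ ->] /andP[_ ->].
have s_aut := swap_stems_aut up vp u_v (only_kidE uS) (only_kidE vS).
have c_tperm x y z : c x = c y -> c (tperm x y z) = c z.
  by move=> c_xy; case: tpermP => [->|->|].
have /c_dist/(_ _)/permP/(_ u) := s_aut; rewrite permM tpermL perm1 => <-.
  have not_kid w : stem r w -> v <> only_kid w.
    move=> wS def_v; have /stemP[k def_w k0] := wS.
    have def_k: v = k by apply/set1P; rewrite -def_w (only_kidE wS) def_v set11.
    by move: k0; rewrite -def_k => /childless_not_stem; rewrite vS.
  by case: tpermP => [/(not_kid u uS) | /(not_kid v vS) |] //.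
by move=> x; rewrite permM !c_tperm.
Qed.

End Swaps.

(** * The fixing set *)

Section AllButOne.

Variable T : finType.
Implicit Type A : {set T}.

Definition all_but_one A : {set T} :=
  if [pick x in A] is Some x then A :\ x else set0.

Lemma card_all_but_one A : #|all_but_one A| = #|A|.-1.
Proof.
rewrite /all_but_one; case: pickP => [x xA | A0]; first by rewrite (cardsD1 x A) xA.
by rewrite cards0 eq_card0.
Qed.

Lemma all_but_oneS A : all_but_one A \subset A.
Proof.
by rewrite /all_but_one; case: pickP => [x _|_]; rewrite ?subD1set ?sub0set.
Qed.

Lemma all_but_one_pair A x y :
  x \in A -> y \in A -> x != y ->
  (x \in all_but_one A) || (y \in all_but_one A).
Proof.
move=> xA yA x_y; rewrite /all_but_one; case: pickP => [z _ | /(_ x)].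
  by rewrite !inE xA yA !andbT -negb_and; apply: contra x_y => /andP[/eqP-> /eqP->].
by rewrite xA.
Qed.

Lemma card_bigcup_le (I : finType) (F : I -> {set T}) :
  #|\bigcup_i F i| <= \sum_i #|F i|.
Proof.
elim/big_ind2: _ => [|m A n B Am Bn|//]; first by rewrite cards0.
by rewrite (leq_trans (leq_card_setU A B)) ?leq_add.
Qed.

End AllButOne.

(** The case where a vertex with a stem child yields no chosen child.  The
    vertex is then chosen itself, and accounts for at least the three vertices
    formed by it and its stem branch, enough to pay for one chosen vertex
    since [4 * 3 >= 11]. *)
Definition lone_stem (G : sgraph) (r p : G) : bool :=
  (#|leaf_kids r p| <= 1) && (#|stem_kids r p| == 1).

Definition local_choice (G : sgraph) (r p : G) : {set G} :=
  all_but_one (leaf_kids r p) :|: all_but_one (stem_kids r p)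
  :|: (if lone_stem r p then [set p] else set0).

Definition fixing_choice (G : sgraph) (r : G) : {set G} :=
  \bigcup_p local_choice r p.

Section Fixing.

Variables (G : sgraph) (r : G).
Hypothesis treeG : tree G.
(* Satisfied by a suitable root of any tree of order at least 3, see
   [exists_clustered_root]. *)
Hypothesis clustered :
  (1 < #|leaf_kids r r|) || (0 < #|stem_kids r r|).

Lemma local_choice_nonempty (v : G) :
  (1 < #|leaf_kids r v|) || (0 < #|stem_kids r v|) ->
  (exists2 x, x \in all_but_one (leaf_kids r v) & x \in fixing_choice r) \/
  (exists2 x, x \in all_but_one (stem_kids r v) & x \in fixing_choice r) \/
  v \in fixing_choice r.
Proof.
have sub x : x \in local_choice r v -> x \in fixing_choice r.
  by move=> xv; apply/bigcupP; exists v.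
have [L2 _ | L1 /= S1] := ltnP 1 #|leaf_kids r v|.
  left; case: (set_0Vmem (all_but_one (leaf_kids r v))) => [A0 | [x xA]].
    by have := card_all_but_one (leaf_kids r v); rewrite A0 cards0; lia.
  by exists x; rewrite ?sub // !inE xA.
right; have [S2 | S_le1] := ltnP 1 #|stem_kids r v|; last first.
  right; apply: sub; rewrite !inE /lone_stem L1 eqn_leq S_le1 S1 set11.
  by rewrite orbT.
left; case: (set_0Vmem (all_but_one (stem_kids r v))) => [A0 | [x xA]].
  by have := card_all_but_one (stem_kids r v); rewrite A0 cards0; lia.
by exists x; rewrite ?sub // !inE xA orbT.
Qed.

Variable s : {perm G}.
Hypothesis s_aut : automorphism s.
Hypothesis s_fix : {in fixing_choice r, s =1 id}.

Let s_adj := automorphismP s s_aut.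

(** A chosen childless vertex below the root has the root as its only
    neighbor.  A chosen stem [x] below the root has only one other neighbor,
    its child [k], which has degree 1, whereas the root has a second stem child
    as not all of them are chosen; so the root cannot move to [k]. *)
Lemma fixes_root : s r = r.
Proof.
case: (local_choice_nonempty clustered) => [[x xA xS] | [[x xA xS] | /s_fix//]].
  have := subsetP (all_but_oneS _) _ xA; rewrite inE => /andP[xr /childlessP x0].
  have : adj x (s r) by rewrite -(s_fix xS) s_adj (kids_adj treeG xr).
  case/(adj_kids treeG r) => [->|]; last by rewrite (negPf (x0 _)).
  by case/kidsP: xr.
have := subsetP (all_but_oneS _) _ xA; rewrite inE => /andP[xr /stemP[k xk k0]].
have : adj x (s r) by rewrite -(s_fix xS) s_adj (kids_adj treeG xr).
have [x_r x_par] := kidsP _ _ _ xr.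
case/(adj_kids treeG r) => [->//|]; rewrite xk => /set1P s_r.
have [k_r k_par] : k != r /\ par r k = x by apply/kidsP; rewrite xk set11.
have sole y : y \in kids r r -> s y = x.
  move/(kids_adj treeG); rewrite -s_adj s_r adj_sym.
  case/(adj_kids treeG r) => [->//|].
  by rewrite (negPf (childlessP _ _ k0 _)).
have : 1 < #|stem_kids r r|.
  have := card_all_but_one (stem_kids r r); rewrite (cardsD1 x) xA; lia.
case/card_gt1P=> y [z []]; rewrite inE => /andP[yr _]; rewrite inE => /andP[zr _].
by case/eqP; apply: (@perm_inj _ s); rewrite !sole.
Qed.

(** Going upwards, either [v] has a big child, fixed by induction, or all its
    children are childless or stems and one of them, or [v], is chosen. *)
Lemma fixes_big (v : G) : ~~ childless r v -> ~~ stem r v -> s v = v.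
Proof.
have s_par := par_aut treeG fixes_root s_aut.
have kid_fixed u w : u \in kids r w -> s u = u -> s w = w.
  by case/kidsP=> _ <- s_u; rewrite -s_par s_u.
elim/(kids_ind treeG (r := r)): v => v IHv v_n0 v_nS.
have [cl | ncl] := boolP ((1 < #|leaf_kids r v|) || (0 < #|stem_kids r v|)).
  case: (local_choice_nonempty cl) => [[x xA xS] | [[x xA xS] | /s_fix//]];
    have := subsetP (all_but_oneS _) _ xA; rewrite inE => /andP[xv _];
    exact: kid_fixed xv (s_fix xS).
have [/existsP[u /and3P[uv u0 uS]] | no_big] :=
    boolP [exists u, [&& u \in kids r v, ~~ childless r u & ~~ stem r u]].
  by apply: kid_fixed (uv) _; apply: IHv.
have S0 u : u \in kids r v -> stem r u = false.
  move=> uv; apply: contraNF ncl => uS; apply/orP; right.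
  by apply/card_gt0P; exists u; rewrite inE uv.
(* Without big or stem children all children are childless; as [v] is neither
   childless nor a stem, there are at least two of them. *)
have allL : {in kids r v, forall u, childless r u}.
  move=> u uv; apply: contraNT no_big => u0; apply/existsP; exists u.
  by rewrite uv u0 S0.
case/negP: v_nS; rewrite /stem; apply/andP; split; last exact/forall_inP.
rewrite eqn_leq card_gt0 v_n0 andbT leqNgt; apply: contra ncl => kids2.
apply/orP; left; apply: leq_trans kids2 (subset_leq_card _).
by apply/subsetP=> u uv; rewrite inE uv allL.
Qed.

(** A vertex that is not big can only move to a sibling of the same kind when
    its parent is fixed, and one of the two is chosen. *)
Lemma fixing_choice_fixes : s = 1%g.
Proof.
apply/permP=> u; rewrite perm1.
have s_r := fixes_root; have s_par := par_aut treeG s_r s_aut.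
elim/(par_ind treeG (r := r)): u => // u u_r s_pu.
have [p u_p] : exists p, par r u = p by exists (par r u).
rewrite u_p in s_pu.
have up : u \in kids r p by apply/kidsP.
have sup : s u \in kids r p.
  by apply/kidsP; rewrite s_par u_p -{1}s_r (inj_eq (@perm_inj _ s)).
have sub A : all_but_one A \subset fixing_choice r ->
  u \in A -> s u \in A -> s u = u.
- move=> /subsetP A_S uA suA; have [// | /(all_but_one_pair suA uA)] := eqVneq (s u) u.
  by case/orP=> /A_S/s_fix; [apply: perm_inj | ].
have [u0 | u_n0] := boolP (childless r u).
  apply: (sub (leaf_kids r p)); last 2 first.
  - by rewrite inE up.
  - by rewrite inE sup (childless_aut treeG s_r s_aut).
  by apply/subsetP=> x xA; apply/bigcupP; exists p; rewrite // !inE xA.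
have [uS | /(fixes_big u_n0) //] := boolP (stem r u).
apply: (sub (stem_kids r p)); last 2 first.
- by rewrite inE up.
- by rewrite inE sup (stem_aut treeG s_r s_aut).
by apply/subsetP=> x xA; apply/bigcupP; exists p; rewrite // !inE xA orbT.
Qed.

End Fixing.

Section Counting.

Variables (G : sgraph) (r : G).

Lemma sum_kids (P : pred G) :
  \sum_p #|[set u in kids r p | P u]| = #|[set u | (u != r) && P u]|.
Proof.
rewrite -[RHS]sum1_card [RHS](partition_big (par r) predT) //=.
apply: eq_bigr => p _; rewrite -sum1_card; apply: eq_bigl => u.
by rewrite !inE; case: (u != r); rewrite //= andbC.
Qed.

Hypothesis treeG : tree G.
Hypothesis leaf2 : forall p, #|leaf_kids r p| <= 2.
Hypothesis stem4 : forall p, #|stem_kids r p| <= 4.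

(** The term [4 * stem r p] on the left takes back the contribution of the one
    leaf below a stem [p]: that leaf is already counted, through the factor 2
    on [#|stem_kids|], at the parent of [p]. *)
Lemma local_count (p : G) :
  11 * #|local_choice r p| + 4 * stem r p <=
  4 * ((~~ childless r p && ~~ stem r p)
       + #|leaf_kids r p| + 2 * #|stem_kids r p|).
Proof.
have card_choice : #|local_choice r p| <=
    #|leaf_kids r p|.-1 + #|stem_kids r p|.-1 + lone_stem r p.
  rewrite -!card_all_but_one; apply: leq_trans (leq_card_setU _ _) _.
  apply: leq_add; first exact: leq_card_setU.
  by case: lone_stem; rewrite ?cards1 ?cards0.
have [p0 | p_n0] := boolP (childless r p).
  have L0 : leaf_kids r p = set0.
    by apply/setP=> u; rewrite !inE; have := childlessP _ _ p0 u; rewrite inE => /negPf->.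
  have S0 : stem_kids r p = set0.
    by apply/setP=> u; rewrite !inE; have := childlessP _ _ p0 u; rewrite inE => /negPf->.
  rewrite childless_not_stem //; move: card_choice.
  by rewrite /lone_stem L0 S0 !cards0 /=; lia.
have [pS | p_nS] := boolP (stem r p).
  have [k pk k0] := stemP _ _ pS.
  have L1 : leaf_kids r p = [set k].
    by apply/setP=> u; rewrite mem_leaf_kids pk; apply/andP/set1P=> [[/set1P]//|->]; rewrite set11.
  have S0 : stem_kids r p = set0.
    apply/setP=> u; rewrite mem_stem_kids pk [RHS]inE; apply/negP=> /andP[/set1P->].
    by rewrite childless_not_stem.
  by move: card_choice; rewrite /lone_stem L1 S0 cards1 cards0 /=; lia.
have := leaf2 p; have := stem4 p; move: card_choice; rewrite /lone_stem /=.
by case: (leqP _ 1); case: (eqVneq _ 1); lia.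
Qed.

(** Summing [local_count] over [p]: childless vertices and stems are the
    children of at most one vertex each, so the right-hand side is at most
    [4 * (#big + #childless + 2 * #stem)], that is [4 * #|G| + 4 * #stem]. *)
Lemma fixing_choice_le : 11 * #|fixing_choice r| <= 4 * #|G|.
Proof.
have kids_le (P : pred G) : \sum_p #|[set u in kids r p | P u]| <= \sum_p P p.
  rewrite sum_kids -sum1_card big_mkcond; apply: leq_sum => p _.
  by rewrite inE; case: (P p); case: (p != r).
have total : #|G| = \sum_p (~~ childless r p && ~~ stem r p)
                    + \sum_p childless r p + \sum_p stem r p.
  rewrite -sum1_card -!big_split; apply: eq_bigr => p _ /=.
  have [p0 | //] := boolP (childless r p); first by rewrite childless_not_stem.
  by case: stem.
have : 11 * (\sum_p #|local_choice r p|) + 4 * (\sum_p stem r p) <=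
    4 * (\sum_p (~~ childless r p && ~~ stem r p)
         + \sum_p #|leaf_kids r p| + 2 * (\sum_p #|stem_kids r p|)).
  rewrite [2 * _]big_distrr -!big_split !big_distrr -big_split.
  by apply: leq_sum => p _; apply: local_count.
have := kids_le (childless r); have := kids_le (stem r).
have := card_bigcup_le (local_choice (G := G) r).
rewrite /leaf_kids /stem_kids /fixing_choice; lia.
Qed.

End Counting.

(** From any first root [r0], go down to a vertex [p] that has children, all of
    them childless.  If there are two of them, [p] is the new root.  If there
    is only one, the new root is the parent of [p], of which [p] becomes a stem
    child; [p] is not [r0], for the tree would then have two vertices.  In
    both cases the branches used keep their shape, since the new root lies on
    the same side of them as [r0]. *)
Lemma exists_clustered_root (G : sgraph) :
  tree G -> 2 < #|G| ->
  exists r : G, (1 < #|leaf_kids r r|) || (0 < #|stem_kids r r|).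
Proof.
move=> treeG n3; have [[/card_gt0P[r0 _] _] _] := treeG.
have [p p_n0 p_kids]: exists2 p : G, ~~ childless r0 p
    & {in kids r0 p, forall u, childless r0 u}.
  have r0_n0 : ~~ childless r0 r0.
    apply/negP=> /childlessP r0_0; have: [set: G] \subset [set r0].
      apply/subsetP=> x _; rewrite inE; apply/eqP; move: x.
      apply: (par_ind treeG (r := r0)) => // u u_r u_par.
      by case/negP: (r0_0 u); apply/kidsP.
    by move/subset_leq_card; rewrite cardsT cards1; lia.
  move: r0_n0; move: {2}r0; apply: (kids_ind treeG (r := r0)) => v IHv v_n0.
  have [/existsP[u /andP[uv u_n0]] | no_u] :=
      boolP [exists u, (u \in kids r0 v) && ~~ childless r0 u].
    exact: IHv uv u_n0.
  exists v => // u uv; apply: contraNT no_u => u_n0.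
  by apply/existsP; exists u; rewrite uv.
have par_p u r : u \in kids r0 p -> adj p r \/ p = r -> u != r -> par r u = p.
  move=> up pr u_r; have u_p := kids_adj treeG up.
  apply: (par_eq treeG u_p).
  case: pr => [pr | ->//]; apply: connect1; rewrite /away pr.
  by rewrite eq_sym (adj_neq u_p) eq_sym.
have kid_nbr u x : u \in kids r0 p -> adj x u -> x = p.
  move=> up; rewrite adj_sym => /(adj_kids treeG r0)[-> | ].
    by case/kidsP: up.
  by rewrite (negPf (childlessP _ _ (p_kids _ up) _)).
have childless_u u r : u \in kids r0 p -> par r p != u -> childless r u.
  move=> up pu; apply/childlessP=> x; apply: contra pu => xu.
  have def_x := kid_nbr u x up (kids_adj treeG xu).
  by case/kidsP: xu => _; rewrite def_x => ->.
have [kids2 | kids1] := ltnP 1 #|kids r0 p|.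
  exists p; apply/orP; left; apply: leq_trans kids2 (subset_leq_card _).
  apply/subsetP=> u up; have u_p := kid_par_neq treeG up.
  rewrite inE childless_u // ?par_root // 1?eq_sym // andbT.
  by apply/kidsP; rewrite (par_p u p) //; right.
have /cards1P[u pu]: #|kids r0 p| == 1.
  by rewrite eqn_leq kids1 card_gt0.
have up : u \in kids r0 p by rewrite pu set11.
have u_n : u != p := kid_par_neq treeG up.
have [p_r | p_nr] := eqVneq p r0.
  have: [set: G] \subset [set p; u].
    apply/subsetP=> x _; rewrite !inE; move: x.
    apply: (par_ind treeG (r := r0)) => [|x x_r]; first by rewrite p_r eqxx.
    case/orP=> /eqP x_par; last first.
      by have /childlessP/(_ x)/kidsP[] := p_kids u up.
    have : x \in kids r0 p by apply/kidsP.
    by rewrite pu => /set1P->; rewrite eqxx orbT.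
  by move/subset_leq_card; rewrite cardsT cards2; case: (_ != _); lia.
have pr := adj_par treeG p_nr; set r := par r0 p in pr.
exists r; apply/orP; right; apply/card_gt0P; exists p.
have par_r_p : par r p = r by apply: (par_eq treeG pr).
have u_r : u != r.
  apply/eqP=> def_u; have /childlessP/(_ p)/kidsP[] := p_kids u up.
  by rewrite def_u.
rewrite inE; apply/andP; split; first by apply/kidsP; rewrite adj_neq.
apply/stemP; exists u; last by rewrite childless_u // par_r_p eq_sym.
apply/setP=> x; rewrite inE; apply/idP/eqP=> [xp | ->]; last first.
  by apply/kidsP; split=> //; apply: par_p => //; left.
have := kids_adj treeG xp; rewrite adj_sym => /(adj_kids treeG r0)[x_r|].
  by case/kidsP: xp; rewrite x_r eqxx.
by rewrite pu => /set1P.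
Qed.

Lemma fixing_number_min (G : sgraph) (S : {set G}) :
  fixing_set S -> fixing_number G <= #|S|.
Proof.
move=> S_fix; rewrite /fixing_number.
by case: arg_minnP => [|A _ A_min]; [exact: fixing_setT | exact: A_min].
Qed.

Lemma fixing_number_bound (G : sgraph) :
  tree G -> distinguishable 2 G -> 2 < #|G| ->
  11 * fixing_number G <= 4 * #|G|.
Proof.
move=> treeG distG n3; have [r r_cl] := exists_clustered_root treeG n3.
apply: (@leq_trans (11 * #|fixing_choice r|)); last first.
  apply: fixing_choice_le => // p; [exact: leaf_kids_le2 | exact: stem_kids_le4].
rewrite leq_mul2l; apply: fixing_number_min.
apply/forallP=> s; apply/implyP=> s_aut; apply/implyP=> /forall_inP s_fix.
by apply/eqP/(fixing_choice_fixes treeG r_cl) => // x /s_fix/eqP.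
Qed.

(** * The extremal spider *)

(** At a highest vertex of a cycle both neighbors would be the image by [f] of
    that vertex. *)
Lemma acyclic_height (G : sgraph) (h : G -> nat) (f : G -> G) :
  (forall x y, adj x y -> h y <= h x -> y = f x) -> acyclic G.
Proof.
move=> adj_f p /andP[p_cyc p_uniq]; rewrite leqNgt; apply/negP=> p3.
have [x0 x0p] : exists x0, x0 \in p by case: (p) p3 => // x q; exists x; apply: mem_head.
have [m mp m_max] := arg_maxnP h (i0 := x0) (P := mem p) x0p.
have [i q def_p] := rot_to mp.
have q2 : 1 < size q by rewrite -ltnS -[(size q).+1]/(size (m :: q)) -def_p size_rot.
have : path.cycle adj (m :: q) by rewrite -def_p rot_cycle.
have : uniq (m :: q) by rewrite -def_p rot_uniq.
have q_le x : x \in q -> h x <= h m.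
  by move=> xq; apply: m_max; rewrite inE -(mem_rot i) def_p inE xq orbT.
case: q q2 q_le {def_p} => // a q; case/lastP: q => // q b _ q_le.
rewrite /= rcons_path last_rcons => /and3P[_ ab _] /and3P[ma _ bm].
case/negP: ab; rewrite (adj_f m a) ?q_le ?mem_head //.
by rewrite -(adj_f m b) ?q_le ?inE ?mem_rcons ?mem_head ?orbT // adj_sym.
Qed.

(** A body, four legs of length two indexed by [bool * bool], each made of a
    knee and a foot (marked [false] and [true]), and two hairs.  Indexing the
    legs by pairs of booleans lets the coloring read off the index: the knee
    and the foot carry its two components as colors. *)
Definition spider_vertex := option ((bool * bool) * bool + bool)%type.

Definition toward_body (x : spider_vertex) : spider_vertex :=
  if x is Some (inl (l, true)) then Some (inl (l, false)) else None.

Definition spider_adj (x y : spider_vertex) : bool :=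
  (x != y) && ((toward_body x == y) || (toward_body y == x)).

Lemma spider_adj_sym : symmetric spider_adj.
Proof. by move=> x y; rewrite /spider_adj eq_sym orbC. Qed.

Lemma spider_adj_irrefl : irreflexive spider_adj.
Proof. by move=> x; rewrite /spider_adj eqxx. Qed.

Definition spider : sgraph := SGraph spider_adj_sym spider_adj_irrefl.

Notation body := (None : spider).
Notation knee l := (Some (inl (l, false)) : spider).
Notation foot l := (Some (inl (l, true)) : spider).
Notation hair b := (Some (inr b) : spider).

Lemma adj_toward_body (x : spider) : x != body -> adj x (toward_body x).
Proof.
move=> x_b; apply/andP; split; last by rewrite eqxx.
by apply/eqP; case: x x_b => [[[l []]|b]|].
Qed.

Lemma adj_spiderP (x y : spider) :
  adj x y -> y = toward_body x \/ x = toward_body y.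
Proof. by case/andP=> _ /orP[] /eqP <-; [left | right]. Qed.

Lemma card_spider : #|spider| = 11.
Proof. by rewrite card_option card_sum !card_prod card_bool. Qed.

Lemma spider_tree : tree spider.
Proof.
split; last first.
  pose h (x : spider) := match x with None => 0 | Some (inl (_, true)) => 2 | _ => 1 end.
  apply: (@acyclic_height spider h toward_body) => x y /andP[_].
  case/orP=> /eqP <- //.
  by case: y => [[[l []] | b]|].
split; first by rewrite card_spider.
have to_body (x : spider) : connect adj x body.
  have step (y : spider) : y != body -> connect adj y (toward_body y).
    by move/adj_toward_body/connect1.
  case: x => [[[l []]|b]|]; last exact: connect0.
  - by apply: connect_trans (step (foot l) _) (step (knee l) _).
  - exact: (step (knee l)).
  - exact: (step (hair b)).
move=> x y; apply: connect_trans (to_body x) _.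
by rewrite (sym_connect_sym (@adj_sym spider)).
Qed.

Section SpiderAutomorphisms.

Variable s : {perm spider}.
Hypothesis s_aut : automorphism s.

Let s_adj := automorphismP s s_aut.
Let s_inj := @perm_inj _ s.

(** The body has three distinct neighbors, while any other vertex has at most
    two: the next vertex toward the body and possibly a foot. *)
Lemma spider_fix_body : s body = body.
Proof.
case def_x: (s body) => [x|//].
(* For a hair the value [(true, true)] is a dummy: hairs have no foot. *)
pose l := if x is inl (l, _) then l else (true, true).
have nbr y : adj body y -> s y \in [:: toward_body (Some x); foot l].
  rewrite -s_adj def_x !inE /l => /andP[_ /orP[/eqP<-|/eqP]].
    by rewrite eqxx.
  by case: (s y) => [[[k []]|b]|] //= [<-]; rewrite eqxx orbT.
pose t := [:: hair true; hair false; knee (true, true)].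
have: uniq (map s t) by rewrite map_inj_uniq.
move/uniq_leq_size/(_ _) => /(_ [:: toward_body (Some x); foot l]).
suff sub : {subset map s t <= [:: toward_body (Some x); foot l]} by move/(_ sub).
by move=> z /mapP[y yt ->]; apply: nbr; move: yt; rewrite !inE => /or3P[]/eqP->.
Qed.

Lemma spider_knee (l : bool * bool) :
  exists2 k, s (knee l) = knee k & s (foot l) = foot k.
Proof.
have f_b : s (foot l) != body by rewrite -spider_fix_body (inj_eq s_inj).
have kf : adj (s (knee l)) (s (foot l)).
  by rewrite s_adj adj_sym (@adj_toward_body (foot l)).
have : adj body (s (knee l)) by rewrite -{1}spider_fix_body s_adj.
have : s (knee l) != body by rewrite -spider_fix_body (inj_eq s_inj).
case: (s (knee l)) kf => [[[k []]|b]|] // /adj_spiderP[def_f | kf] _ _.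
- by rewrite def_f in f_b.
- by case: (s (foot l)) f_b kf => [[[k' []]|b]|] //= _ [->]; exists k'.
- by rewrite def_f in f_b.
- by case: (s (foot l)) f_b kf => [[[k' []]|b']|].
Qed.

Lemma spider_hair (b : bool) : exists b', s (hair b) = hair b'.
Proof.
have : adj body (s (hair b)) by rewrite -spider_fix_body s_adj.
case def_y: (s (hair b)) => [[[k []]|b']|] // _; last by exists b'.
have : adj (hair b) ((s^-1)%g (foot k)).
  by rewrite -s_adj permKV def_y adj_sym (@adj_toward_body (foot k)).
case/andP=> _; case def_z: ((s^-1)%g (foot k)) => [[[l []]|c]|] // _.
by have := spider_fix_body; rewrite -{1}def_z permKV.
Qed.

End SpiderAutomorphisms.

Definition spider_color (x : spider) : 'I_2 :=
  inZp (match x with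
        | Some (inl (l, false)) => l.1
        | Some (inl (l, true)) => l.2
        | Some (inr b) => b
        | None => false
        end : bool).

Lemma spider_distinguishable : distinguishable 2 spider.
Proof.
exists spider_color => s s_aut s_col; apply/permP=> x; rewrite perm1.
have inZp_inj (a b : bool) : inZp (p' := 1) a = inZp b -> a = b.
  by case: a b => [] [].
have knee_foot l : s (knee l) = knee l /\ s (foot l) = foot l.
  have [k s_k s_f] := spider_knee s_aut l.
  have /inZp_inj /= k1 := s_col (knee l); have /inZp_inj /= k2 := s_col (foot l).
  move: k1 k2; rewrite s_k s_f /=.
  by case: k l {s_k s_f} => [? ?] [? ?] /= -> ->.
case: x => [[[l []]|b]|].
- exact: (knee_foot l).2.
- exact: (knee_foot l).1.
- have [b' s_b] := spider_hair s_aut b.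
  by have /inZp_inj := s_col (hair b); rewrite s_b => ->.
- exact: spider_fix_body.
Qed.

Definition spider_map (f : bool * bool -> bool * bool) (g : bool -> bool)
    (x : spider) : spider :=
  match x with
  | Some (inl (l, e)) => Some (inl (f l, e))
  | Some (inr b) => hair (g b)
  | None => body
  end.

Lemma spider_map_inj f g : injective f -> injective g -> injective (spider_map f g).
Proof.
move=> f_inj g_inj [[[l e]|b]|] [[[l' e']|b']|] //= [].
  by move=> /f_inj-> ->.
by move=> /g_inj->.
Qed.

Lemma spider_map_aut f g (f_inj : injective f) (g_inj : injective g) :
  automorphism (perm (spider_map_inj f_inj g_inj)).
Proof.
have m_inj := spider_map_inj f_inj g_inj.
apply/automorphismP=> x y; rewrite !permE.
have toward z : toward_body (spider_map f g z) = spider_map f g (toward_body z).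
  by case: z => [[[l []]|b]|].
by rewrite /adj /= /spider_adj !toward !(inj_eq m_inj).
Qed.

(** A fixing set meets a hair, and meets all legs but at most one, for otherwise two
    hairs or two legs could be exchanged. *)
Lemma spider_fixing_set (S : {set spider}) : fixing_set S -> 3 < #|S|.
Proof.
move/forallP=> S_fix.
have rigid f g (f_inj : injective f) (g_inj : injective g) :
    {in S, spider_map f g =1 id} -> spider_map f g =1 id.
  move=> fg_S x; have := S_fix (perm (spider_map_inj f_inj g_inj)).
  rewrite spider_map_aut /= => /implyP/(_ _)/eqP/permP/(_ x).
  rewrite permE perm1; apply; apply/forall_inP=> y yS.
  by rewrite permE fg_S.
have [b bS] : exists b, hair b \in S.
  apply/existsP; apply: contraT => /existsPn no_hair.
  have swapS : {in S, spider_map id negb =1 id}.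
    by case=> [[[l e]|b]|] //; rewrite (negPf (no_hair b)).
  by have := rigid _ _ (@inj_id _) negb_inj swapS (hair true).
pose hit := [set l | (knee l \in S) || (foot l \in S)].
have hit3 : 2 < #|hit|.
  have := cardsC hit; rewrite card_prod card_bool.
  suff : #|~: hit| <= 1 by lia.
  rewrite leqNgt; apply/negP=> /card_gt1P[l [l' [l_out l'_out l_l']]].
  have S_out k e : Some (inl (k, e)) \in S -> k \in hit.
    by rewrite inE; case: e => ->; rewrite ?orbT.
  have swapS : {in S, spider_map (tperm l l') id =1 id}.
    case=> [[[k e]|b']|] // /S_out k_hit /=; rewrite tpermD //.
      by apply: contraTneq k_hit => <-; rewrite -in_setC.
    by apply: contraTneq k_hit => <-; rewrite -in_setC.
  have := rigid _ _ (@perm_inj _ (tperm l l')) (@inj_id _) swapS (knee l).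
  by rewrite /= tpermL => -[def_l]; rewrite def_l eqxx in l_l'.
pose rep l := if knee l \in S then knee l else foot l.
have rep_inj : injective rep.
  by move=> l k; rewrite /rep; do 2!case: ifP => _; case.
rewrite (cardsD1 (hair b)) bS ltnS (leq_trans hit3) //.
rewrite -(card_imset _ rep_inj); apply/subset_leq_card/subsetP=> x.
case/imsetP=> l; rewrite inE /rep => l_hit ->.
by move: l_hit; case: ifP => [kS _ | _ /= fS]; rewrite !inE.
Qed.

Theorem theorem5 :
  (forall T : sgraph, tree T -> distinguishable 2 T -> 3 <= #|T| ->
     (fixing_density T <= 4%:R / 11%:R)%R)
  /\
  (exists T : sgraph,
     [/\ tree T, distinguishable 2 T, 3 <= #|T|
       & fixing_density T = (4%:R / 11%:R)%R]).
Proof.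
split=> [T treeT distT T3|].
  have := fixing_number_bound treeT distT T3.
  have T_gt0 : (0 < #|T|%:R :> rat)%R by rewrite ltr0n; lia.
  rewrite /fixing_density ler_pdivrMr // mulrAC ler_pdivlMr //.
  by rewrite -!natrM ler_nat mulnC.
exists spider; rewrite /fixing_density card_spider; split=> //.
- exact: spider_tree.
- exact: spider_distinguishable.
have spider_F : fixing_number spider = 4.
  apply/eqP; rewrite eqn_leq; apply/andP; split.
    have := fixing_number_bound spider_tree spider_distinguishable.
    by rewrite card_spider => /(_ isT); lia.
  rewrite /fixing_number; case: arg_minnP => [|S S_fix _]; first exact: fixing_setT.
  exact: spider_fixing_set.
by rewrite spider_F.
Qed.
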